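(* Assume that $m>n\ge4$ and $d\ge 422\log(4n)$. There exists a triplet $(\sigma^\#,\theta^\#,\pi^* )$ such that $\bar\kappa_{\text{in-in}}=\bar\kappa_{\text{in-out}}=\sqrt{d/20}$ and $$\inf_{\hat\pi\in\mathcal M}\mathbf P_{\theta^\#,\sigma^\#,\pi^*}\big(\hat\pi\ne\pi^*\big)>\frac14,$$ where $\mathcal M$ is the set of all distance based $M$-estimators of $\pi^*$.
   Context: Notation: $[n]=\{1,\dots,n\}$; $\|\cdot\|$ is the Euclidean norm on $\mathbb R^d$; $\mathbb R_+=[0,\infty)$. Model. Let $m>n$ and $d\ge1$ be integers. The parameters are $\theta^\#=(\theta^\#_1,\dots,\theta^\#_m)$ with $\theta^\#_j\in\mathbb R^d$, $\sigma^\#=(\sigma^\#_1,\dots,\sigma^\#_m)$ with $\sigma_j^\#>0$, and an injective map $\pi^*:[n]\to[m]$. For $i\in[n]$ put $\theta_i=\theta^\#_{\pi^*(i)}$ and $\sigma_i=\sigma^\#_{\pi^*(i)}$. One observes $$X_i=\theta_i+\sigma_i\xi_i\ (i\in[n]),\qquad X^\#_j=\theta^\#_j+\sigma^\#_j\xi^\#_j\ (j\in[m]),$$ where $\xi_1,\dots,\xi_n,\xi^\#_1,\dots,\xi^\#_m$ are independent standard Gaussian vectors in $\mathbb R^d$ (zero mean, identity covariance). The law of $(X_1,\dots,X_n,X_1^\#,\dots,X_m^\#)$ is denoted $\mathbf P_{\theta^\#,\sigma^\#,\pi^*}$. The outlier index set is $O_{\pi^*}=[m]\setminus\mathrm{Im}(\pi^*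 )$. Separation distances: $$\bar\kappa_{\text{in-in}}=\min_{\substack{i,j\notin O_{\pi^*}\\ i\ne j}}\frac{\|\theta^\#_i-\theta^\#_j\|}{((\sigma^\#_i)^2+(\sigma^\#_j)^2)^{1/2}},\qquad \bar\kappa_{\text{in-out}}=\min_{\substack{i\notin O_{\pi^*}\\ j\in O_{\pi^*}}}\frac{\|\theta^\#_i-\theta^\#_j\|}{((\sigma^\#_i)^2+(\sigma^\#_j)^2)^{1/2}}.$$ Distance based $M$-estimators: an estimator $\hat\pi$ of $\pi^*$ (a function of the observations with values in the set of injective maps $[n]\to[m]$) is a distance based $M$-estimator if, for a sequence of non-decreasing functions $\rho_i:\mathbb R_+\to\mathbb R$, $i=1,\dots,n$, $$\hat\pi\in\arg\min_{\pi:[n]\to[m]}\sum_{i=1}^n\rho_i\big(\|X_i-X^\#_{\pi(i)}\|\big),$$ the minimum being over all injective maps $\pi:[n]\to[m]$. $\mathcal M$ denotes the set of all distance based $M$-estimators.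
   Formalization: If the choice among minimizers is free, the claim fails: with all ρ_i=0 the constant estimator π* is in M. So ties in the argmin are broken by an arbitrary linear order on matching maps, fixed before the triplet, which may depend on it; estimators are measurable. *)

(* Defs.v *)
(* Library world: MathComp and MathComp-Analysis. *)
From HB Require Import structures.
From mathcomp Require Import all_boot all_order all_algebra.
From mathcomp Require Import all_classical all_reals all_analysis.

Set Implicit Arguments.
Unset Strict Implicit.
Unset Printing Implicit Defensive.

Import Order.TTheory GRing.Theory Num.Theory.

Local Open Scope classical_set_scope.
Local Open Scope ring_scope.

(* R^d is [d.-tuple R], with the product Borel sigma-algebra of the library;
   the norms that the library puts on R^d are not Euclidean. *)
Definition edist (R : realType) (d : nat) (x y : d.-tuple R) : R :=
  Num.sqrt (\sum_(k < d) (tnth x k - tnth y k) ^+ 2).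

Section noise.
Context {R : realType} {disp : measure_display} {Omega : measurableType disp}.
Variable P : probability Omega R.

(* Taking some of the [B i] equal to [setT] gives the product rule for every
   subfamily. *)
Definition mutually_independent (disp' : measure_display)
    (S : measurableType disp') (I : finType) (X : I -> Omega -> S) : Prop :=
  forall B : I -> set S, (forall i, measurable (B i)) ->
  P (\bigcap_(i in [set: I]) X i @^-1` B i) =
  (\prod_(i : I) P (X i @^-1` B i))%E.

Definition standard_gaussian (d : nat) (X : {RV P >-> d.-tuple R}) : Prop :=
  mutually_independent (fun (k : 'I_d) w => tnth (X w) k) /\
  forall (k : 'I_d) (B : set R), measurable B ->
    P [set w | B (tnth (X w) k)] = normal_prob 0 1 B.

Definition gaussian_noise (n m d : nat) (xi : 'I_n -> {RV P >-> d.-tuple R})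
    (xis : 'I_m -> {RV P >-> d.-tuple R}) : Prop :=
  [/\ forall i, standard_gaussian (xi i),
      forall j, standard_gaussian (xis j) &
      mutually_independent (fun (s : 'I_n + 'I_m) (w : Omega) =>
        match s with inl i => xi i w | inr j => xis j w end)].

End noise.

Definition observations (R : realType) (n m d : nat) : Type :=
  (n.-tuple (d.-tuple R) * m.-tuple (d.-tuple R))%type.

Definition noisy (R : realType) (d : nat) (theta : d.-tuple R) (sigma : R)
    (xi : d.-tuple R) : d.-tuple R :=
  [tuple tnth theta k + sigma * tnth xi k | k < d].

Section model.
Context {R : realType} {n m d : nat}.
Variables (thetas : 'I_m -> d.-tuple R) (sigmas : 'I_m -> R).
Variable pi : {ffun 'I_n -> 'I_m}.

Definition observe (xi : 'I_n -> d.-tuple R) (xis : 'I_m -> d.-tuple R) :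
    observations R n m d :=
  ([tuple noisy (thetas (pi i)) (sigmas (pi i)) (xi i) | i < n],
   [tuple noisy (thetas j) (sigmas j) (xis j) | j < m]).

Definition outliers : {set 'I_m} := ~: [set pi i | i : 'I_n].

Definition separation (i j : 'I_m) : R :=
  edist (thetas i) (thetas j) / Num.sqrt (sigmas i ^+ 2 + sigmas j ^+ 2).

Definition kappa_in_in : \bar R :=
  \big[Order.min/+oo%E]_(p : 'I_m * 'I_m |
      [&& p.1 \notin outliers, p.2 \notin outliers & p.1 != p.2])
    (separation p.1 p.2)%:E.

Definition kappa_in_out : \bar R :=
  \big[Order.min/+oo%E]_(p : 'I_m * 'I_m |
      (p.1 \notin outliers) && (p.2 \in outliers))
    (separation p.1 p.2)%:E.

End model.

Section M_estimators.
Context {R : realType} {n m d : nat}.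

Definition M_objective (rho : 'I_n -> R -> R) (x : observations R n m d)
    (pi : {ffun 'I_n -> 'I_m}) : R :=
  \sum_(i < n) rho i (edist (tnth x.1 i) (tnth x.2 (pi i))).

Definition M_argmin (rho : 'I_n -> R -> R) (x : observations R n m d) :
    set {ffun 'I_n -> 'I_m} :=
  [set pi : {ffun _ -> _} | injective pi /\
     forall pi' : {ffun 'I_n -> 'I_m}, injective pi' ->
       M_objective rho x pi <= M_objective rho x pi'].

(* A function with values in a finite set is measurable when its fibers are. *)
Definition estimator (pihat : observations R n m d -> {ffun 'I_n -> 'I_m}) :
    Prop :=
  (forall x, injective (pihat x)) /\
  (forall pi, measurable [set x | pihat x = pi]).

Definition linear_order (T : Type) (le : rel T) : Prop :=
  [/\ total le, transitive le & antisymmetric le].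

(* Non-decreasing functions may have plateaus, and then the minimizer need not
   be unique.  Ties are broken by a linear order [le] on the matching maps:
   if the choice among the minimizers were free, then with constant [rho] every
   estimator would be a distance based M-estimator, even the one that is
   constantly equal to the true matching map. *)
Definition distance_based_M_estimator (le : rel {ffun 'I_n -> 'I_m})
    (pihat : observations R n m d -> {ffun 'I_n -> 'I_m}) : Prop :=
  estimator pihat /\
  exists rho : 'I_n -> R -> R,
    (forall i x y, 0 <= x -> x <= y -> rho i x <= rho i y) /\
    forall x, M_argmin rho x (pihat x) /\
      forall pi, M_argmin rho x pi -> le (pihat x) pi.

End M_estimators.

(* Main.v *)
Require Import Defs.
From HB Require Import structures.
From mathcomp Require Import all_boot all_order all_algebra.
From mathcomp Require Import all_classical all_reals all_analysis.
From mathcomp Require Import measurable_realfun ring lra.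

Import Order.TTheory GRing.Theory Num.Theory.

Local Open Scope classical_set_scope.
Local Open Scope ring_scope.

(** A distance based M-estimator only looks at distances, so it is misled when
    an inlier has a large variance and an outlier has a tiny one.  Take every
    inlier variance equal to 1 and every outlier variance equal to s^2 with s
    minute, all the thetas on one axis, and an inlier with theta = 0.  For this
    inlier the squared distance from X to its true match is about 2d, whereas
    the squared distance to an outlier at separation sqrt(d/20) is only about
    d + d/20.  Redirecting this single index to the outlier then does not
    increase any term of the objective, whatever the non-decreasing functions
    rho are.

    The redirected map may merely tie with the true one, and then the order le
    decides.  It is fixed before the parameters, so the true map can be chosen
    as the le-greatest injective map ([exists_le_max]); a tie is then always
    lost by the true map ([M_estimator_avoids_le_max]).

    It remains to see that the outlier is at least as close as the true match
    with probability more than 1/4.  Write the noises of X, of its match and of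
    the outlier as x, y, z, and the position of the outlier as t.  The outlier
    is at least as close iff
      |y|^2 - 2 <x, y - t> + 2 s <x, z> - |t + s z|^2 >= 0.
    Three facts make this likely ([outlier_closer_probability]):
    - <x, y - t> <= 0 has probability at least 1/2, because the law of (x, y)
      is invariant under x -> -x ([gaussian_inner_product_le0]);
    - |y|^2 is at least 43d/400, slightly more than 2|t|^2, except with
      probability O(1/d): at least half of the coordinates are expected to
      satisfy |y_k| >= 1/2, and their number concentrates by Chebyshev's
      inequality ([gaussian_sqnorm_lower]);
    - the terms with z are negligible once s is small compared with a bound T
      that all coordinates of x and z satisfy with high probability
      ([gaussian_coordinate_tail]).
    Using a sign symmetry and a count of coordinates, rather than the moments of
    the quadratic form, only costs a factor 2 in the probability, which
    the bound 1/4 can afford. *)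

(** * The standard normal law *)

Lemma normal_probN (R : realType) (A : set R) : measurable A ->
  normal_prob 0 1 (-%R @^-1` A) = normal_prob 0 1 A :> \bar R.
Proof.
move=> mA; rewrite /normal_prob.
have even_pdf (x : R) : normal_pdf 0 1 (- x) = normal_pdf 0 1 x.
  by rewrite !normal_pdfE ?oner_eq0// /normal_fun !subr0 sqrrN.
under eq_integral do rewrite -even_pdf.
pose f : R -> \bar R := fun x => (normal_pdf 0 1 x)%:E.
have mN : measurable_fun [set: measurableTypeR R]
    (-%R : measurableTypeR R -> measurableTypeR R).
  exact: oppr_measurable.
rewrite -(@ge0_integral_pushforward _ _ _ _ _ _ mN lebesgue_measure A f)//.
- by apply: eq_measure_integral => //= B mB _; exact: lebesgue_measureN.
- apply/measurable_EFinP.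
  exact: (@measurable_funS _ _ _ _ _ _ _ _ _ (measurable_normal_pdf 0 1)).
- by move=> x _; rewrite /f lee_fin normal_pdf_ge0.
Qed.

Lemma normal_prob_tail (R : realType) (e : R) : 0 < e ->
  exists2 T : R, 1 <= T &
    (normal_prob 0 1 [set x : R | (T < `|x|)%R] <= e%:E)%E.
Proof.
move=> e0.
have mabs : measurable_fun [set: measurableTypeR R]
    (@Num.norm R R : measurableTypeR R -> R).
  exact: normr_measurable.
pose Pr : probability (measurableTypeR R) R := normal_prob 0 1.
pose X : {RV Pr >-> R} :=
  @mfun_Sub _ _ (measurableTypeR R) _ (@Num.norm R R) (mem_set mabs).
have : nbhs (0%:E : \bar R) [set y | (y < e%:E)%E].
  by apply: open_ereal_lt'; rewrite lte_fin.
move=> /(cvg_ccdfy0 X)[M [_ tailM]].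
pose T := Num.max 1 (M + 1).
exists T; first by rewrite le_max lexx.
have MT : M < T by rewrite lt_max ltrDl ltr01 orbT.
have := tailM T MT; rewrite /ccdf /distribution /pushforward /= => /ltW.
congr (_ <= _)%E; congr (normal_prob 0 1 _).
by apply/seteqP; split=> x /=; rewrite in_itv/= andbT.
Qed.

(** The density is at most its peak 1/sqrt(2 pi), which is at most 1/2 because
    pi >= 2; so the interval ]-1/2, 1/2[ of length 1 has mass at most 1/2. *)
Lemma normal_prob_abs_half (R : realType) :
  ((1 / 2)%:E <= normal_prob 0 1 [set x : R | (1 / 2 <= `|x|)%R])%E.
Proof.
pose S := `](- (1 / 2)), (1 / 2 : R)[%classic.
have mS : measurable S by exact: measurable_itv.
have -> : [set x : R | 1 / 2 <= `|x|] = ~` S.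
  apply/seteqP; split=> x; rewrite /S /= in_itv/= -ltr_norml.
    by rewrite ltNge => ->.
  by move/negP; rewrite -leNgt.
have peak_half : normal_peak 1 <= (1 / 2 : R).
  rewrite /normal_peak expr1n mul1r.
  have two_le : 2 <= Num.sqrt (pi *+ 2 : R).
    rewrite -[leLHS]ger0_norm// -sqrtr_sqr ler_wsqrtr//.
    by have := pi_ge2 R; lra.
  by rewrite mul1r lef_pV2 ?posrE ?(lt_le_trans _ two_le).
have half : (normal_prob 0 1 S <= (1 / 2)%:E)%E.
  apply: (@le_trans _ _ (\int[lebesgue_measure]_(x in S) (cst (1 / 2)%:E x)))%E.
    apply: ge0_le_integral => //.
    - by move=> x _; rewrite lee_fin normal_pdf_ge0.
    - apply/measurable_EFinP.
      exact: (@measurable_funS _ _ _ _ _ _ _ _ _ (measurable_normal_pdf 0 1)).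
    - move=> x _; rewrite lee_fin (le_trans _ peak_half)//.
      by rewrite normal_pdf_ub ?oner_eq0.
  rewrite integral_cst//= lebesgue_measure_itv/= lte_fin.
  rewrite ifT; last by lra.
  by rewrite -EFinD -EFinM lee_fin; lra.
have compl : (normal_prob 0 1 (~` S) = 1 - normal_prob 0 1 S)%E.
  exact: (probability_setC (normal_prob 0 1) mS).
have fS : normal_prob 0 1 S \is a fin_num by exact: fin_num_measure.
move: half; rewrite compl -(fineK fS); set p := fine _.
by rewrite -EFinB !lee_fin; lra.
Qed.

(** * Counting pairwise independent events *)

Section pairwise_independent_events.
Context {R : realType} {disp : measure_display} {Omega : measurableType disp}.
Variables (P : probability Omega R) (d : nat) (A : 'I_d -> set Omega) (q : R).
Hypothesis mA : forall k, measurable (A k).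
Hypothesis PA : forall k, P (A k) = q%:E.
Hypothesis indepA : forall k l, k != l -> P (A k `&` A l) = (q * q)%:E.

Let count (w : Omega) : R := \sum_(k < d) \1_(A k) w.

Let meas_count : measurable_fun [set: Omega] count.
Proof. by apply: measurable_sum => k; exact: measurable_indic. Qed.

Let integral_sum_indic (I : finType) (B : I -> set Omega) :
  (forall i, measurable (B i)) ->
  (\int[P]_w (\sum_i \1_(B i) w)%:E = \sum_i P (B i))%E.
Proof.
move=> mB; under eq_integral do rewrite -sumEFin.
rewrite ge0_integral_sum//.
- by apply: eq_bigr => i _; rewrite integral_indic ?setIT.
- by move=> i; apply/measurable_EFinP; exact: measurable_indic.
Qed.

(** The variance is that of a binomial variable: only products of two indicators
    occur in the expanded square, so pairwise independence suffices. *)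
Lemma integral_sqr_deviation :
  (\int[P]_w ((count w - d%:R * q) ^+ 2)%:E = (d%:R * (q * (1 - q)))%:E)%E.
Proof.
have count_ge0 w : 0 <= count w by apply: sumr_ge0 => k _.
have q0 : 0 <= q \/ d = 0%N.
  case: d A PA => [|d'] A' PA'; first by right.
  by left; rewrite -lee_fin -(PA' ord0).
have dq0 : 0 <= d%:R * q.
  by case: q0 => [?|->]; [rewrite mulr_ge0|rewrite mul0r].
have E1 : (\int[P]_w (count w)%:E = (d%:R * q)%:E)%E.
  rewrite integral_sum_indic//; under eq_bigr do rewrite PA.
  by rewrite sumEFin sumr_const card_ord mulr_natl.
have E2 : (\int[P]_w (count w ^+ 2)%:E
           = (d%:R * q + d%:R * (d%:R - 1) * (q * q))%:E)%E.
  transitivity (\int[P]_w (\sum_(p : 'I_d * 'I_d) \1_(A p.1 `&` A p.2) w)%:E)%E.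
    apply: eq_integral => w _; congr EFin.
    rewrite expr2 /count big_distrlr/= pair_big/=.
    by apply: eq_bigr => p _; rewrite indicI.
  rewrite integral_sum_indic//; last by move=> p; exact: measurableI.
  rewrite -(pair_big xpredT xpredT (fun k l => P (A k `&` A l)))/=.
  have row (k : 'I_d) : (\sum_(l < d) P (A k `&` A l)
                 = (q + (d%:R - 1) * (q * q))%:E)%E.
    rewrite (bigD1 k)//= setIid PA.
    rewrite (eq_bigr (fun=> (q * q)%:E)); last first.
      by move=> l lk; rewrite indepA// eq_sym.
    rewrite sumEFin sumr_const cardC1 card_ord -EFinD; congr (_ + _)%:E.
    rewrite -[LHS]mulr_natl; congr (_ * _).
    by case: d k => [[]//|d'] _; rewrite -natr1 addrK.
  under eq_bigr do rewrite row.
  rewrite sumEFin sumr_const card_ord -mulr_natl; congr EFin; ring.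
have mE (f : Omega -> R) : measurable_fun [set: Omega] f ->
    measurable_fun [set: Omega] (EFin \o f) by move=> ?; exact/measurable_EFinP.
have mdev : measurable_fun [set: Omega] (fun w => (count w - d%:R * q) ^+ 2).
  by apply: measurable_funX; apply: measurable_funB.
(* The cross term of the expanded square is moved to the left-hand side, so that
   only integrals of non-negative functions are added. *)
have : (\int[P]_w ((count w - d%:R * q) ^+ 2)%:E
        + \int[P]_w ((2 * (d%:R * q))%:E * (count w)%:E)
        = \int[P]_w (count w ^+ 2)%:E + \int[P]_w ((d%:R * q) ^+ 2)%:E)%E.
  rewrite -!ge0_integralD//.
  - by apply: eq_integral => w _; rewrite -EFinM -!EFinD; congr EFin; ring.
  - by move=> w _; rewrite lee_fin sqr_ge0.
  - by apply: mE; exact: measurable_funX.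
  - by move=> w _; rewrite lee_fin sqr_ge0.
  - by move=> w _; rewrite lee_fin sqr_ge0.
  - exact: (mE _ mdev).
  - move=> w _; rewrite -EFinM lee_fin.
    by apply: mulr_ge0 => //; apply: mulr_ge0.
  - apply: (mE (fun w => 2 * (d%:R * q) * count w)).
    by apply: measurable_funM => //; exact: measurable_cst.
rewrite ge0_integralZl_EFin//; last 3 first.
  - by move=> w _; rewrite lee_fin.
  - exact/mE.
  - by rewrite mulr_ge0.
have E3 : (\int[P]_w ((d%:R * q) ^+ 2)%:E = ((d%:R * q) ^+ 2)%:E)%E.
  by rewrite integral_cst// -[RHS]mule1; congr *%E; exact: probability_setT.
rewrite E1 E2 E3.
case: (\int[P]_w _)%E => [r| |]//=; rewrite -!EFinM -!EFinD => -[rE].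
by congr EFin; lra.
Qed.

(** Chebyshev's inequality, with the variance bounded uniformly in q by
    q (1 - q) <= 1/4. *)
Lemma chebyshev_count (a : R) : 0 < a ->
  let E := [set w | (a <= `|count w - d%:R * q|)%R] in
  measurable E /\ (P E <= (d%:R / (4%:R * a ^+ 2))%:E)%E.
Proof.
move=> a0 E.
have mZ : measurable_fun [set: Omega] (fun w => count w - d%:R * q).
  exact: measurable_funB.
split.
  rewrite (_ : E = setT `&`
    (fun w => `|count w - d%:R * q|) @^-1` `[a, +oo[%classic).
    exact: (measurableT_comp (@normr_measurable R setT) mZ).
  by apply/seteqP; split=> w; rewrite /E /= in_itv /= andbT => // -[].
pose Z : {RV P >-> R} := @mfun_Sub _ _ Omega _ _ (mem_set mZ).
have m_sqr : measurable_fun [set: R] (fun x : R => x ^+ 2).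
  exact: measurable_funX.
have sqr_homo : {in Num.nneg &, {homo (fun x : R => x ^+ 2) : x y / x <= y}}.
  by move=> x y; rewrite !nnegrE => x0 y0 xy; rewrite lerXn2r.
have := markov Z a0 m_sqr (fun r _ => sqr_ge0 r) sqr_homo.
rewrite unlock /=.
under eq_integral do rewrite /= real_normK ?num_real//.
rewrite integral_sqr_deviation => markovZ.
rewrite -(@lee_pmul2l _ (a ^+ 2)%:E)//; last by rewrite lte_fin exprn_gt0.
apply: le_trans markovZ _; rewrite -EFinM lee_fin.
have -> : a ^+ 2 * (d%:R / (4%:R * a ^+ 2)) = d%:R * (1 / 4) :> R.
  by field; rewrite gt_eqF.
by rewrite ler_wpM2l//; have := sqr_ge0 (q - 1 / 2); lra.
Qed.

End pairwise_independent_events.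

(** * Sign symmetry of Gaussian vectors *)

(** The boxes form a pi-system that generates the product sigma-algebra, so a
    finite measure on tuples is determined by its values on boxes. *)
Lemma tuple_measure_unique {R : realType} {dT : measure_display}
    {T : measurableType dT} (n : nat)
    (m1 m2 : {measure set (n.-tuple T) -> \bar R}) :
  (m1 [set: n.-tuple T] < +oo)%E ->
  (forall B : 'I_n -> set T, (forall k, measurable (B k)) ->
    m1 (\bigcap_(k in [set: 'I_n]) (@tnth n T ^~ k @^-1` B k)) =
    m2 (\bigcap_(k in [set: 'I_n]) (@tnth n T ^~ k @^-1` B k))) ->
  forall C, measurable C -> m1 C = m2 C.
Proof.
move=> m1fin m12.
pose box (B : 'I_n -> set T) : set (n.-tuple T) :=
  \bigcap_(k in [set: 'I_n]) (@tnth n T ^~ k @^-1` B k).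
pose G := [set C | exists2 B, forall k, measurable (B k) & C = box B].
have GT : G setT.
  by exists (fun=> setT) => //; apply/seteqP; split.
apply: (@measure_unique _ _ _ G (fun=> setT)) => //.
- apply/seteqP; split.
    apply: smallest_sub; first exact: smallest_sigma_algebra.
    move=> C; rewrite -bigcup_seq => -[/= k _ [B mB <-]].
    apply: sub_sigma_algebra.
    (* a cylinder is a box with all its other sides full *)
    exists (fun l => if l == k then B else setT).
      by move=> l; case: ifP.
    rewrite setTI; apply/seteqP; split=> x /=.
      by move=> Bx l _ /=; case: eqP => // ->.
    by move=> /(_ k I) /=; rewrite eqxx.
  apply: smallest_sub; first exact: sigma_algebra_measurable.
  move=> _ [B mB ->]; apply: fin_bigcap_measurable => //.
  by move=> k _; rewrite -[X in measurable X]setTI; exact: measurable_tnth.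
- move=> _ _ [B1 mB1 ->] [B2 mB2 ->].
  exists (fun k => B1 k `&` B2 k); first by move=> k; exact: measurableI.
  by rewrite /box -bigcapI.
- by rewrite bigcup_const.
- by move=> _ [B mB ->]; exact: m12.
Qed.

Definition tuple_opp {R : realType} {d : nat} (x : d.-tuple R) : d.-tuple R :=
  [tuple - tnth x k | k < d].

Lemma measurable_tuple_opp (R : realType) (d : nat) :
  measurable_fun [set: d.-tuple R] tuple_opp.
Proof.
apply/measurable_fun_tnthP => k.
rewrite (_ : _ \o _ = fun x => - tnth x k).
  exact: measurableT_comp (@oppr_measurable R setT) (measurable_tnth k).
by apply/funext => x /=; rewrite tnth_mktuple.
Qed.

Section independence.
Context {R : realType} {disp : measure_display} {Omega : measurableType disp}.
Variable P : probability Omega R.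

(** Mutual independence gives the product rule on full families of sets; the
    sides other than i and j are taken to be the whole space. *)
Lemma mutually_independent2 (dS : measure_display) (S : measurableType dS)
    (J : finType) (X : J -> Omega -> S) (i j : J) (A B : set S) :
  mutually_independent P X -> i != j -> measurable A -> measurable B ->
  P (X i @^-1` A `&` X j @^-1` B) = (P (X i @^-1` A) * P (X j @^-1` B))%E.
Proof.
move=> indep ij mA mB.
pose C k := if k == i then A else if k == j then B else setT.
have mC k : measurable (C k) by rewrite /C; case: ifP => // _; case: ifP.
have := indep C mC; rewrite (bigD1 i)//= (bigD1 j) 1?eq_sym//= big1.
  rewrite mule1 /C eqxx eq_sym (negbTE ij) eqxx => <-; congr (P _).
  apply/seteqP; split=> w /=.
    by move=> [Aw Bw] k _ /=; case: eqP => [->//|_]; case: eqP => [->|].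
  move=> all_w; split; first by have := all_w i Logic.I; rewrite eqxx.
  by have := all_w j Logic.I; rewrite eq_sym (negbTE ij) eqxx.
move=> k /andP[ki kj]; rewrite /C (negbTE ki) (negbTE kj) preimage_setT.
exact: probability_setT.
Qed.

(** Independent symmetric coordinates make the probabilities of all boxes
    invariant under x -> -x, hence the whole law is. *)
Lemma standard_gaussian_opp (d : nat) (X : {RV P >-> d.-tuple R})
    (A : set (d.-tuple R)) :
  standard_gaussian X -> measurable A ->
  P [set w | A (tuple_opp (X w))] = P [set w | A (X w)].
Proof.
move=> [indepX lawX] mA.
have mX : measurable_fun [set: Omega] X by exact: measurable_funPT.
have mNX := measurableT_comp (@measurable_tuple_opp R d) mX.
pose NX : {RV P >-> d.-tuple R} := @mfun_Sub _ _ Omega _ _ (mem_set mNX).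
apply: (@tuple_measure_unique _ _ _ _ (distribution P NX) (distribution P X))
  => // [|B mB].
  exact: fin_num_fun_lty.
rewrite /distribution /pushforward.
have mNB k : measurable (-%R @^-1` B k).
  by rewrite -[X in measurable X]setTI; exact: oppr_measurable.
transitivity (P (\bigcap_(k in [set: 'I_d])
    ((fun w => tnth (X w) k) @^-1` (-%R @^-1` B k)))).
  congr (P _); apply/seteqP; split=> w /= Bw k _ /=; have := Bw k Logic.I;
    by rewrite /= tnth_mktuple.
transitivity (P (\bigcap_(k in [set: 'I_d])
    ((fun w => tnth (X w) k) @^-1` B k))); last by [].
rewrite !indepX//; apply: eq_bigr => k _.
by rewrite !lawX// normal_probN.
Qed.

(** Both pairs have the same marginals and are independent, so both joint laws
    are the same product measure. *)
Lemma independent_gaussian_opp (d : nat) (X Y : {RV P >-> d.-tuple R})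
    (C : set (d.-tuple R * d.-tuple R)) :
  standard_gaussian X ->
  (forall A B, measurable A -> measurable B ->
    P (X @^-1` A `&` Y @^-1` B) = (P (X @^-1` A) * P (Y @^-1` B))%E) ->
  measurable C ->
  P [set w | C (tuple_opp (X w), Y w)] =
  P [set w | C (X w, Y w)].
Proof.
move=> gX indepXY mC.
have mX : measurable_fun [set: Omega] X by exact: measurable_funPT.
have mY : measurable_fun [set: Omega] Y by exact: measurable_funPT.
have mXY := measurable_fun_pair mX mY.
have mNXY :=
  measurable_fun_pair (measurableT_comp (@measurable_tuple_opp R d) mX) mY.
pose XY : {RV P >-> _} := @mfun_Sub _ _ Omega _ _ (mem_set mXY).
pose NXY : {RV P >-> _} := @mfun_Sub _ _ Omega _ _ (mem_set mNXY).
have lawXY A B : measurable A -> measurable B ->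
    distribution P XY (A `*` B) = (distribution P X A * distribution P Y B)%E.
  exact: indepXY.
have lawNXY A B : measurable A -> measurable B ->
    distribution P NXY (A `*` B) = (distribution P X A * distribution P Y B)%E.
  move=> mA mB; transitivity (P ([set w | A (tuple_opp (X w))] `&` Y @^-1` B)).
    by [].
  have mNA : measurable (tuple_opp @^-1` A).
    by rewrite -[X in measurable X]setTI; exact: measurable_tuple_opp.
  transitivity (P [set w | A (tuple_opp (X w))] * P (Y @^-1` B))%E.
    exact: (indepXY _ _ mNA mB).
  by rewrite (standard_gaussian_opp _ _ _ gX mA).
have eNXY := @product_measure_unique _ _ _ _ _ (distribution P X)
  (distribution P Y) (distribution P NXY) lawNXY C mC.
have eXY := @product_measure_unique _ _ _ _ _ (distribution P X)
  (distribution P Y) (distribution P XY) lawXY C mC.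
exact: etrans (esym eNXY) eXY.
Qed.

(** The event and its image under x -> -x have the same probability and cover
    the whole space. *)
Lemma gaussian_inner_product_le0 (d : nat) (X Y : {RV P >-> d.-tuple R})
    (t : d.-tuple R) :
  standard_gaussian X ->
  (forall A B, measurable A -> measurable B ->
    P (X @^-1` A `&` Y @^-1` B) = (P (X @^-1` A) * P (Y @^-1` B))%E) ->
  let E := [set w |
    (\sum_(k < d) tnth (X w) k * (tnth (Y w) k - tnth t k) <= 0)%R] in
  measurable E /\ ((1 / 2)%:E <= P E)%E.
Proof.
move=> gX indepXY E.
pose f (xy : d.-tuple R * d.-tuple R) : R :=
  \sum_(k < d) tnth xy.1 k * (tnth xy.2 k - tnth t k).
have mf : measurable_fun setT f.
  apply: measurable_sum => k; apply: measurable_funM.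
    exact: measurableT_comp (measurable_tnth k) measurable_fst.
  apply: measurable_funB => //.
  exact: measurableT_comp (measurable_tnth k) measurable_snd.
pose C := [set xy | f xy <= 0].
have mC : measurable C.
  rewrite (_ : C = setT `&` f @^-1` `]-oo, 0]); first exact: mf.
  by apply/seteqP; split=> x; rewrite /C /= in_itv /= => // -[].
have mX : measurable_fun [set: Omega] X by exact: measurable_funPT.
have mY : measurable_fun [set: Omega] Y by exact: measurable_funPT.
have mXY := measurable_fun_pair mX mY.
have mNXY :=
  measurable_fun_pair (measurableT_comp (@measurable_tuple_opp R d) mX) mY.
pose E' := [set w | C (tuple_opp (X w), Y w)].
have mE : measurable E.
  by rewrite -[X in measurable X]setTI; exact: (mXY measurableT C mC).
have mE' : measurable E'.
  by rewrite -[X in measurable X]setTI; exact: (mNXY measurableT C mC).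
split=> //.
have PE' : P E' = P E := independent_gaussian_opp _ _ _ _ gX indepXY mC.
have cover : E `|` E' = setT.
  apply/seteqP; split=> // w _.
  have [fw|fw] := leP (f (X w, Y w)) 0; first by left.
  right; rewrite /E' /C /f /=.
  under eq_bigr do rewrite tnth_mktuple mulNr.
  by rewrite sumrN oppr_le0 ltW.
have : (1 <= P E + P E)%E.
  rewrite -{2}PE' -(probability_setT P) -cover; exact: measureU2.
have fE : P E \is a fin_num by exact: fin_num_measure.
by rewrite -(fineK fE) -EFinD !lee_fin; lra.
Qed.

End independence.

(** * High-probability bounds for Gaussian vectors *)

Section gaussian_vectors.
Context {R : realType} {disp : measure_display} {Omega : measurableType disp}.
Variable P : probability Omega R.

Lemma finite_union_bound (J : finType) (A : J -> set Omega) (x : \bar R) :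
  (forall j, measurable (A j)) -> (forall j, (P (A j) <= x)%E) ->
  let E := [set w | exists j, A j w] in
  measurable E /\ (P E <= \sum_(j : J) x)%E.
Proof.
move=> mA PA E.
have -> : E = \big[setU/set0]_(j : J) A j.
  rewrite -bigcup_seq; apply/seteqP; split=> w [j]; last by exists j.
  by exists j => //=; rewrite mem_index_enum.
elim/big_ind2: _ => [|B y C z [mB By] [mC Cz]|j _].
- by rewrite measure0.
- split; first exact: measurableU.
  by apply: le_trans (measureU2 _ _ _) _ => //; exact: leeD.
- by split.
Qed.

Lemma gaussian_coordinate_tail (d : nat) (X : {RV P >-> d.-tuple R}) (T x : R) :
  standard_gaussian X ->
  (normal_prob 0 1 [set x : R | (T < `|x|)%R] <= x%:E)%E ->
  let E := [set w | exists k, (T < `|tnth (X w) k|)%R] in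
  measurable E /\ (P E <= (d%:R * x)%:E)%E.
Proof.
move=> [_ lawX] tail.
have mT : measurable [set x : R | (T < `|x|)%R].
  rewrite (_ : [set _ | _] = setT `&` Num.norm @^-1` `]T, +oo[%classic).
    exact: normr_measurable.
  by apply/seteqP; split=> y; rewrite /= in_itv /= andbT => // -[].
have mX : measurable_fun [set: Omega] X by exact: measurable_funPT.
have mXk k := measurableT_comp (measurable_tnth k) mX.
have [k||mE PE] := finite_union_bound 'I_d
  (fun k => [set w | [set x : R | (T < `|x|)%R] (tnth (X w) k)]) x%:E.
- rewrite -[X in measurable X]setTI.
  exact: (mXk k measurableT _ mT).
- by move=> k; rewrite lawX.
split=> //; apply: le_trans PE _.
by rewrite sumEFin sumr_const card_ord mulr_natl.
Qed.

(** The number of coordinates with |x_k| >= 1/2 has mean at least d/2, so it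
    falls below 43d/100 only by deviating by at least 7d/100; and each such
    coordinate contributes at least 1/4 to the squared norm. *)
Lemma gaussian_sqnorm_lower (d : nat) (X : {RV P >-> d.-tuple R}) :
  (0 < d)%N -> standard_gaussian X ->
  let E := [set w |
    (\sum_(k < d) tnth (X w) k ^+ 2 < 43%:R / 400%:R * d%:R)%R] in
  measurable E /\ (P E <= (52%:R / d%:R)%:E)%E.
Proof.
move=> d0 [indepX lawX] E.
have mX : measurable_fun [set: Omega] X by exact: measurable_funPT.
have mXk k := measurableT_comp (measurable_tnth k) mX.
have mE : measurable E.
  have mS : measurable_fun setT (fun w => \sum_(k < d) tnth (X w) k ^+ 2).
    by apply: measurable_sum => k; apply: measurable_funX; exact: mXk.
  rewrite (_ : E = setT `&`
      (fun w => \sum_(k < d) tnth (X w) k ^+ 2) @^-1`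
        `]-oo, (43%:R / 400%:R * d%:R)[%classic).
    exact: mS.
  by apply/seteqP; split=> w; rewrite /E /= in_itv /= => // -[].
split=> //.
pose L := [set x : R | (1 / 2 <= `|x|)%R].
have mL : measurable L.
  rewrite (_ : L = setT `&` Num.norm @^-1` `[(1 / 2), +oo[%classic).
    exact: normr_measurable.
  by apply/seteqP; split=> y; rewrite /L /= in_itv /= andbT => // -[].
pose q := fine (normal_prob 0 1 L).
have qE : normal_prob 0 1 L = q%:E.
  by rewrite fineK//; exact: fin_num_measure.
have q_half : 1 / 2 <= q by rewrite -lee_fin -qE; exact: normal_prob_abs_half.
pose A k := [set w | L (tnth (X w) k)].
have mA k : measurable (A k).
  by rewrite -[X in measurable X]setTI; exact: (mXk k measurableT _ mL).
have PA k : P (A k) = q%:E by rewrite lawX.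
have indepA k l : k != l -> P (A k `&` A l) = (q * q)%:E.
  move=> kl; rewrite EFinM -{1}(PA k) -(PA l).
  exact: (mutually_independent2 P _ _ _ _ _ _ _ _ indepX kl).
have d_gt0 : 0 < d%:R :> R by rewrite ltr0n.
have a0 : 0 < 7%:R / 100%:R * d%:R :> R by rewrite mulr_gt0// divr_gt0.
have [mF PF] := chebyshev_count P d A q mA PA indepA _ a0.
apply: (@le_trans _ _ (P [set w |
  (7%:R / 100%:R * d%:R <= `|\sum_(k < d) \1_(A k) w - d%:R * q|)%R])).
  apply: le_measure; rewrite ?inE// => w; rewrite /E /= => small.
  have count_le :
      \sum_(k < d) \1_(A k) w <= 4%:R * \sum_(k < d) tnth (X w) k ^+ 2 :> R.
    rewrite mulr_sumr; apply: ler_sum => k _.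
    rewrite indicE; have [|_] := boolP (w \in A k); last first.
      by rewrite mulr_ge0// sqr_ge0.
    rewrite inE /A /L /= => half.
    by rewrite -real_normK ?num_real//; nra.
  rewrite distrC ger0_norm; nra.
apply: le_trans PF _; rewrite lee_fin.
have -> : d%:R / (4%:R * (7%:R / 100%:R * d%:R) ^+ 2) =
    (10000%:R / 196%:R) / d%:R :> R.
  by field; rewrite gt_eqF.
by rewrite ler_pM2r ?invr_gt0//; lra.
Qed.

End gaussian_vectors.

(** * A collinear configuration with the prescribed separations *)

Lemma exists_outlier {n m : nat} (pi : {ffun 'I_n -> 'I_m}) :
  (n < m)%N -> exists j, j \in outliers pi.
Proof.
move=> nm; apply/set0Pn.
rewrite -card_gt0 /outliers cardsCs finset.setCK card_ord subn_gt0.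
apply: leq_ltn_trans nm.
by rewrite -[X in (_ <= X)%N]card_ord; exact: leq_imset_card.
Qed.

Section collinear_configuration.
Context {R : realType} {n m : nat}.
Variables (pi : {ffun 'I_n -> 'I_m}) (s c : R) (d : nat).
Hypotheses (pi_inj : injective pi) (c_ge0 : 0 <= c) (d_gt0 : (0 < d)%N).

Definition axis_point (t : R) : d.-tuple R :=
  [tuple if k == 0%N :> nat then t else 0 | k < d].

Definition config_sigma (j : 'I_m) : R := if j \in outliers pi then s else 1.

(** The inliers lie on the non-positive half-axis with constant spacing, which
    makes neighbouring ones exactly c apart in separation distance; all the
    outliers share the point of the positive half-axis that is c apart from the
    inlier 0. *)
Definition config_position (j : 'I_m) : R :=
  if [pick i | pi i == j] is Some i then - (c * Num.sqrt 2 * i%:R)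
  else c * Num.sqrt (1 + s ^+ 2).

Definition config_theta (j : 'I_m) : d.-tuple R :=
  axis_point (config_position j).

Lemma sum_axis_point (t : R) (f : R -> R) : f 0 = 0 ->
  \sum_(k < d) f (tnth (axis_point t) k) = f t.
Proof.
move=> f0; rewrite (bigD1 (Ordinal d_gt0))//= tnth_mktuple eqxx big1 ?addr0//.
by move=> k k0; rewrite tnth_mktuple ifN.
Qed.

Lemma edist_axis_point (t u : R) :
  Defs.edist (axis_point t) (axis_point u) = `|t - u|.
Proof.
rewrite /Defs.edist -sqrtr_sqr; congr Num.sqrt.
rewrite -(sum_axis_point (t - u) (fun x => x ^+ 2)) ?expr0n//.
apply: eq_bigr => k _; rewrite !tnth_mktuple; case: ifP => // _.
by rewrite subr0.
Qed.

Lemma inlierP j : reflect (exists i, j = pi i) (j \notin outliers pi).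
Proof.
rewrite /outliers inE negbK; apply: (iffP imsetP) => [[i _ ->]|[i ->]].
  by exists i.
by exists i.
Qed.

Lemma config_sigma_in i : config_sigma (pi i) = 1.
Proof. by rewrite /config_sigma ifN//; apply/inlierP; exists i. Qed.

Lemma config_sigma_out j : j \in outliers pi -> config_sigma j = s.
Proof. by rewrite /config_sigma => ->. Qed.

Lemma config_position_in i :
  config_position (pi i) = - (c * Num.sqrt 2 * i%:R).
Proof.
rewrite /config_position; case: pickP => [i' /eqP/pi_inj -> //|/(_ i)].
by rewrite eqxx.
Qed.

Lemma config_position_out j : j \in outliers pi ->
  config_position j = c * Num.sqrt (1 + s ^+ 2).
Proof.
move=> oj; rewrite /config_position; case: pickP => // i /eqP pij.
have : j \notin outliers pi by apply/inlierP; exists i.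
by rewrite oj.
Qed.

Lemma separation_in_in i i' :
  separation config_theta config_sigma (pi i) (pi i') =
  c * `|i%:R - i'%:R|.
Proof.
rewrite /separation edist_axis_point !config_position_in !config_sigma_in.
have sqrt2 : Num.sqrt (2 : R) != 0 by rewrite gt_eqF// sqrtr_gt0.
have -> : - (c * Num.sqrt 2 * i%:R) - - (c * Num.sqrt 2 * i'%:R) =
  (c * Num.sqrt 2) * (i'%:R - i%:R) by ring.
rewrite !expr1n normrM [`|c * _|]ger0_norm ?mulr_ge0// distrC.
by rewrite mulrAC mulfK.
Qed.

Lemma separation_in_out i j : j \in outliers pi ->
  separation config_theta config_sigma (pi i) j =
  c * (Num.sqrt 2 * i%:R / Num.sqrt (1 + s ^+ 2) + 1).
Proof.
move=> oj; rewrite /separation edist_axis_point config_position_in.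
rewrite config_position_out// config_sigma_in config_sigma_out// expr1n.
have q0 : 0 < Num.sqrt (1 + s ^+ 2).
  by rewrite sqrtr_gt0 ltr_pwDl// sqr_ge0.
rewrite -opprD normrN ger0_norm; last first.
  by rewrite addr_ge0// ?mulr_ge0// ltW.
by field; rewrite gt_eqF.
Qed.

Lemma config_kappa_in_in : (1 < n)%N ->
  kappa_in_in config_theta config_sigma pi = c%:E.
Proof.
move=> n1; apply/eqP; rewrite eq_le; apply/andP; split.
  pose i0 : 'I_n := Ordinal (ltnW n1); pose i1 : 'I_n := Ordinal n1.
  have p01 : [&& pi i1 \notin outliers pi, pi i0 \notin outliers pi
               & pi i1 != pi i0].
    apply/and3P; split; [by apply/inlierP; exists i1|
      by apply/inlierP; exists i0|by apply/eqP => /pi_inj].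
  apply: le_trans (bigmin_le_cond _ (j := (pi i1, pi i0)) _ p01) _.
  by rewrite lee_fin /= separation_in_in/= subr0 normr1 mulr1.
apply: le_bigmin => [|[j j'] /and3P[/inlierP[i /= ->] /inlierP[i' /= ->] ii']].
  by rewrite leey.
rewrite lee_fin separation_in_in ler_peMr//.
have {}ii' : (i : nat) != i' by apply: contraNneq ii' => /val_inj ->.
have [lt_ii'|lt_i'i|eq_ii'] := ltngtP i i'; last by rewrite eq_ii' eqxx in ii'.
  by rewrite distrC ger0_norm ?subr_ge0 ?ler_nat 1?ltnW// lerBrDl natr1 ler_nat.
by rewrite ger0_norm ?subr_ge0 ?ler_nat 1?ltnW// lerBrDl natr1 ler_nat.
Qed.

Lemma config_kappa_in_out : (0 < n)%N -> (n < m)%N ->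
  kappa_in_out config_theta config_sigma pi = c%:E.
Proof.
move=> n0 nm; apply/eqP; rewrite eq_le; apply/andP; split.
  have [out outP] := exists_outlier pi nm.
  pose i0 : 'I_n := Ordinal n0.
  have p0o : (pi i0 \notin outliers pi) && (out \in outliers pi).
    by rewrite outP andbT; apply/inlierP; exists i0.
  apply: le_trans (bigmin_le_cond _ (j := (pi i0, out)) _ p0o) _.
  by rewrite lee_fin /= separation_in_out//= mulr0 mul0r add0r mulr1.
apply: le_bigmin => [|[j j'] /andP[/inlierP[i /= ->] /= oj']].
  by rewrite leey.
rewrite lee_fin separation_in_out// ler_peMr// lerDr.
by rewrite mulr_ge0// ?mulr_ge0// invr_ge0.

Qed.

End collinear_configuration.

(** * Failure of distance based M-estimators *)

(** The true matching map is taken greatest for the tie-breaking order, so that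
    it loses every tie. *)
Lemma exists_le_max {n m : nat} (le : rel {ffun 'I_n -> 'I_m}) :
  (n <= m)%N -> linear_order le ->
  exists2 pi : {ffun 'I_n -> 'I_m}, injective pi &
    forall pi' : {ffun 'I_n -> 'I_m}, injective pi' -> le pi' pi.
Proof.
move=> nm [le_total le_trans _].
pose inj : pred {ffun 'I_n -> 'I_m} := fun pi => injectiveb pi.
pose ge : rel {ffun 'I_n -> 'I_m} := fun x y => le y x.
have inj0 : inj [ffun i => widen_ord nm i].
  by apply/injectiveP => i j; rewrite !ffunE => /(congr1 val) /= /val_inj.
have ge_refl : reflexive ge by move=> x; have := le_total x x; rewrite orbb.
have ge_trans : transitive ge by move=> y x z xy yz; exact: le_trans yz xy.
have ge_total : total ge by move=> x y; exact: le_total.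
have [pi /injectiveP pi_inj pi_max] :=
  extremumP id ge_refl ge_trans ge_total inj0.
by exists pi => // pi' /injectiveP; exact: pi_max.
Qed.

(** Redirecting i to the outlier j keeps the map injective and changes only the
    i-th term of the objective, which does not increase because rho i is
    non-decreasing.  So if pi were selected, the redirected map would be a
    minimizer too, and le would prefer it. *)
Lemma M_estimator_avoids_le_max {R : realType} {n m d : nat}
    (le : rel {ffun 'I_n -> 'I_m}) (pi : {ffun 'I_n -> 'I_m})
    (pihat : observations R n m d -> {ffun 'I_n -> 'I_m})
    (x : observations R n m d) (i : 'I_n) (j : 'I_m) :
  linear_order le -> injective pi ->
  (forall pi' : {ffun 'I_n -> 'I_m}, injective pi' -> le pi' pi) ->
  distance_based_M_estimator le pihat -> j \in outliers pi ->
  Defs.edist (tnth x.1 i) (tnth x.2 j) <=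
    Defs.edist (tnth x.1 i) (tnth x.2 (pi i)) ->
  pihat x <> pi.
Proof.
move=> [_ _ le_anti] pi_inj pi_max [_ [rho [rho_mono pihat_min]]] oj closer hit.
have [[_ pi_min] pi_first] := pihat_min x; rewrite hit in pi_min pi_first.
have pi_neq_j k : pi k != j.
  by apply: contraTneq oj => <-; apply/inlierP; exists k.
pose pi' := [ffun k => if k == i then j else pi k].
have pi'_inj : injective pi'.
  move=> k l; rewrite !ffunE; case: eqP => [->|_]; case: eqP => [->|_] //.
  - by move=> ejl; have := pi_neq_j l; rewrite -ejl eqxx.
  - by move=> ekj; have := pi_neq_j k; rewrite ekj eqxx.
  - exact: pi_inj.
have objective_le : M_objective rho x pi' <= M_objective rho x pi.
  apply: ler_sum => k _; rewrite ffunE; case: eqP => [->|_] //.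
  by apply: rho_mono => //; exact: sqrtr_ge0.
have pi'_min : M_argmin rho x pi'.
  split=> // pi'' pi''_inj; exact: le_trans objective_le (pi_min _ pi''_inj).
have pi_pi' : pi = pi'.
  by apply: le_anti; rewrite pi_first// pi_max.
by have := pi_neq_j i; rewrite pi_pi' ffunE !eqxx.
Qed.

(** Here x, y, z are the noises of an observation, of its true match and of an
    outlier, and t is the displacement of the outlier.  Since (t + s z)^2 is at
    most 2 t^2 + 2 s^2 z^2, it suffices that |y|^2 exceed 2 |t|^2, which is
    about d/10 = 40d/400, by the small terms coming from z; the constant 43/400
    leaves room for them. *)
Lemma outlier_sqdist_le {R : realType} {d : nat} (x y z t : 'I_d -> R)
    (s T : R) :
  (forall k, `|x k| <= T) -> (forall k, `|z k| <= T) -> 1 <= T ->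
  0 < s -> s * T ^+ 2 = 1 / 1000%:R ->
  \sum_(k < d) x k * (y k - t k) <= 0 ->
  43%:R / 400%:R * d%:R <= \sum_(k < d) y k ^+ 2 ->
  \sum_(k < d) t k ^+ 2 = d%:R / 20%:R * (1 + s ^+ 2) ->
  \sum_(k < d) (x k - (t k + s * z k)) ^+ 2 <= \sum_(k < d) (x k - y k) ^+ 2.
Proof.
move=> xT zT T1 s0 sT xy ty tt.
have T0 : 0 <= T by exact: le_trans T1.
have sqr_le u : `|u| <= T -> u ^+ 2 <= T ^+ 2.
  by move=> uT; rewrite -[leLHS]real_normK ?num_real// lerXn2r// nnegrE.
have s_small : s <= 1 / 1000%:R.
  by rewrite -sT ler_peMr ?exprn_ege1// ltW.
(* b is kept opaque, so that mulr_sumr does not pull the factors of T ^+ 2 out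
   of the sum of the constant b *)
have [b bE] : exists b, b = 2 * (s * T ^+ 2) + 2 * (s * (s * T ^+ 2)).
  by eexists.
have pointwise k : (x k - (t k + s * z k)) ^+ 2 <= (x k - y k) ^+ 2
    + (2 * (x k * (y k - t k)) - y k ^+ 2 + 2 * t k ^+ 2 + b).
  have x2 := sqr_le _ (xT k).
  have z2 := sqr_le _ (zT k).
  have xz : - (x k * z k) <= T ^+ 2.
    by have := sqr_ge0 (x k + z k); nra.
  have sxz : s * - (x k * z k) <= s * T ^+ 2 by rewrite ler_wpM2l// ltW.
  have ssz : s * (s * z k ^+ 2) <= s * (s * T ^+ 2).
    by rewrite !ler_wpM2l// ltW.
  by have := sqr_ge0 (t k - s * z k); rewrite bE; lra.
apply: (le_trans (ler_sum _ (fun k _ => pointwise k))).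
rewrite !big_split/= sumrN -!mulr_sumr tt sumr_const card_ord.
rewrite -[b *+ d]mulr_natl.
have d0 : 0 <= d%:R :> R by [].
have : d%:R * b <= d%:R * (1 / 400%:R).
  by rewrite ler_wpM2l// bE sT; lra.
have : d%:R * s ^+ 2 <= d%:R * (1 / 400%:R).
  by rewrite ler_wpM2l//; nra.
lra.
Qed.

(** * Probability of the failure *)

Lemma ln_quadruple_ge {R : realType} (n : nat) : (4 <= n)%N ->
  15%:R / 16%:R <= ln (4%:R * n%:R) :> R.
Proof.
move=> n4.
have n4R : 4 <= n%:R :> R by rewrite ler_nat.
have x0 : 0 < 4%:R * n%:R :> R by lra.
have := @expR_ge1Dx R (- ln (4%:R * n%:R)).
rewrite expRN lnK ?posrE// => lower.
have : (4%:R * n%:R)^-1 <= (16%:R : R)^-1 by rewrite lef_pV2 ?posrE//; lra.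
lra.
Qed.

Section observation_law.
Context {R : realType} {disp : measure_display} {Omega : measurableType disp}.
Variables (P : probability Omega R) (n m d : nat).

Lemma measurable_noisy (theta : d.-tuple R) (sigma : R)
    (X : {RV P >-> d.-tuple R}) :
  measurable_fun [set: Omega] (fun w => noisy theta sigma (X w)).
Proof.
have mX : measurable_fun [set: Omega] X by exact: measurable_funPT.
apply/measurable_fun_tnthP => k.
rewrite (_ : _ \o _ = fun w => tnth theta k + sigma * tnth (X w) k).
  apply: measurable_funD => //; apply: measurable_funM => //.
  exact: measurableT_comp (measurable_tnth k) mX.
by apply/funext => w /=; rewrite tnth_mktuple.
Qed.

Lemma measurable_observe (thetas : 'I_m -> d.-tuple R) (sigmas : 'I_m -> R)
    (pi : {ffun 'I_n -> 'I_m}) (xi : 'I_n -> {RV P >-> d.-tuple R})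
    (xis : 'I_m -> {RV P >-> d.-tuple R}) :
  measurable_fun [set: Omega] (fun w =>
    observe thetas sigmas pi (fun i => xi i w) (fun j => xis j w)).
Proof.
apply: measurable_fun_pair; apply/measurable_fun_tnthP => i.
  rewrite (_ : _ \o _ =
      fun w => noisy (thetas (pi i)) (sigmas (pi i)) (xi i w)).
    exact: measurable_noisy.
  by apply/funext => w /=; rewrite tnth_mktuple.
rewrite (_ : _ \o _ = fun w => noisy (thetas i) (sigmas i) (xis i w)).
  exact: measurable_noisy.
by apply/funext => w /=; rewrite tnth_mktuple.
Qed.

(** On the event <X, Y - t> <= 0, of probability at least 1/2, either F holds,
    or |Y|^2 is small, or some coordinate of X or Z exceeds T.  The exceptional
    events have total probability at most 52/395 + 2/100 < 1/6.  The
    indirection through F avoids asking for the event of the last hypothesis to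
    be measurable. *)
Lemma outlier_closer_probability (X Y Z : {RV P >-> d.-tuple R})
    (t : d.-tuple R) (s T : R) (F : set Omega) :
  395%:R <= d%:R :> R ->
  standard_gaussian X -> standard_gaussian Y -> standard_gaussian Z ->
  (forall A B, measurable A -> measurable B ->
    P (X @^-1` A `&` Y @^-1` B) = (P (X @^-1` A) * P (Y @^-1` B))%E) ->
  1 <= T -> 0 < s -> s * T ^+ 2 = 1 / 1000%:R ->
  (normal_prob 0 1 [set x : R | (T < `|x|)%R] <= (1 / 100%:R / d%:R)%:E)%E ->
  \sum_(k < d) tnth t k ^+ 2 = d%:R / 20%:R * (1 + s ^+ 2) ->
  measurable F ->
  (forall w, \sum_(k < d) (tnth (X w) k - (tnth t k + s * tnth (Z w) k)) ^+ 2 <=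
     \sum_(k < d) (tnth (X w) k - tnth (Y w) k) ^+ 2 -> F w) ->
  ((1 / 3%:R)%:E <= P F)%E.
Proof.
move=> d395 gX gY gZ indepXY T1 s0 sT tail tt mF closerF.
have d_gt0 : 0 < d%:R :> R by lra.
have d_pos : (0 < d)%N by rewrite -(ltr0n R).
have [mE PE] := gaussian_inner_product_le0 P d X Y t gX indepXY.
have [mN PN] := gaussian_sqnorm_lower P d Y d_pos gY.
have [mX PX] := gaussian_coordinate_tail P d X T _ gX tail.
have [mZ PZ] := gaussian_coordinate_tail P d Z T _ gZ tail.
set E := [set w | _] in mE PE.
set N := [set w | _] in mN PN.
set BX := [set w | _] in mX PX.
set BZ := [set w | _] in mZ PZ.
have cover : E `<=` (F `|` N) `|` (BX `|` BZ).
  move=> w Ew.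
  have [BXw|nBX] := pselect (BX w); first by right; left.
  have [BZw|nBZ] := pselect (BZ w); first by right; right.
  have [Nw|nN] := pselect (N w); first by left; right.
  left; left; apply: closerF.
  apply: (outlier_sqdist_le _ _ _ _ s T) => //.
  - by move=> k; rewrite leNgt; apply/negP => ?; apply: nBX; exists k.
  - by move=> k; rewrite leNgt; apply/negP => ?; apply: nBZ; exists k.
  - by rewrite leNgt; exact/negP.
have fin : P F \is a fin_num by exact: fin_num_measure.
have : (P E <= P F + (52%:R / d%:R)%:E
        + ((d%:R * (1 / 100%:R / d%:R))%:E
           + (d%:R * (1 / 100%:R / d%:R))%:E))%E.
  have mFN : measurable (F `|` N) by exact: measurableU.
  have mB : measurable (BX `|` BZ) by exact: measurableU.
  apply: (le_trans (le_measure P _ _ cover)); rewrite ?inE//.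
    exact: measurableU.
  apply: (le_trans (measureU2 P mFN mB)); apply: leeD.
    by apply: (le_trans (measureU2 P mF mN)); exact: leeD.
  by apply: (le_trans (measureU2 P mX mZ)); exact: leeD.
move=> /(le_trans PE); rewrite -(fineK fin) -!EFinD !lee_fin.
have -> : d%:R * (1 / 100%:R / d%:R) = 1 / 100%:R :> R.
  by field; rewrite gt_eqF.
have : 52%:R / d%:R <= 52%:R / 395%:R :> R.
  by rewrite ler_pM2l// lef_pV2 ?posrE.
lra.
Qed.

End observation_law.

Theorem theorem3 (R : realType) (n m d : nat)
    (hn : (4 <= n)%N) (hm : (n < m)%N) (hd1 : (1 <= d)%N)
    (hd : 422%:R * ln (4%:R * n%:R) <= d%:R :> R)
    (le : rel {ffun 'I_n -> 'I_m}) (hle : linear_order le) :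
  exists (sigmas : 'I_m -> R) (thetas : 'I_m -> d.-tuple R)
         (pistar : {ffun 'I_n -> 'I_m}),
    [/\ (forall j, 0 < sigmas j) /\ injective pistar,
        kappa_in_in thetas sigmas pistar = (Num.sqrt (d%:R / 20%:R))%:E,
        kappa_in_out thetas sigmas pistar = (Num.sqrt (d%:R / 20%:R))%:E &
        forall (disp : measure_display) (Omega : measurableType disp)
          (P : probability Omega R)
          (xi : 'I_n -> {RV P >-> d.-tuple R})
          (xis : 'I_m -> {RV P >-> d.-tuple R}),
          gaussian_noise xi xis ->
          ((1 / 4)%:E <
            ereal_inf
              [set P [set w | pihat (observe thetas sigmas pistar
                                       (fun i => xi i w) (fun j => xis j w))
                              <> pistar]
              | pihat in distance_based_M_estimator le])%E].
Proof.
(* 395 is a little less than 422 * 15 / 16 *)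
have d395 : 395%:R <= d%:R :> R by have := @ln_quadruple_ge R n hn; lra.
have d_gt0 : 0 < d%:R :> R by lra.
have [pi pi_inj pi_max] := exists_le_max le (ltnW hm) hle.
have [out outP] := exists_outlier pi hm.
(* with this tail at T, the d coordinates of a noise vector are all bounded by T
   except with probability 1/100 *)
have x0 : 0 < 1 / 100%:R / d%:R :> R by rewrite divr_gt0// divr_gt0.
have [T T1 tail] := normal_prob_tail R _ x0.
have T0 : 0 < T by exact: lt_le_trans T1.
pose s : R := 1 / 1000%:R / T ^+ 2.
have TT0 : 0 < T ^+ 2 by exact: exprn_gt0.
have s0 : 0 < s by apply: divr_gt0 TT0; lra.
have sT : s * T ^+ 2 = 1 / 1000%:R by apply: divfK; rewrite gt_eqF.
pose c : R := Num.sqrt (d%:R / 20%:R).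
have c0 : 0 <= c by exact: sqrtr_ge0.
exists (config_sigma pi s), (config_theta pi s c d), pi; split.
- by split=> // j; rewrite /config_sigma; case: ifP.
- by apply: config_kappa_in_in => //; exact: leq_trans hn.
- by apply: config_kappa_in_out => //; exact: leq_trans hn.
move=> disp Omega P xi xis [gxi gxis indep].
have n_gt0 : (0 < n)%N by exact: leq_trans hn.
(* the index 0 is the one whose inlier sits at the origin *)
pose i0 : 'I_n := Ordinal n_gt0.
apply: (@lt_le_trans _ _ (1 / 3%:R)%:E).
  by rewrite lte_fin; lra.
apply: le_ereal_inf_tmp => _ [pihat pihatM <-].
have mobs := measurable_observe P n m d (config_theta pi s c d)
  (config_sigma pi s) pi xi xis.
apply: (outlier_closer_probability P d (xi i0) (xis (pi i0)) (xis out)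
  (config_theta pi s c d out) s T) => //.
- move=> A B mA mB.
  exact: (mutually_independent2 P _ _ _ _ (inl i0) (inr (pi i0)) A B indep).
- rewrite (sum_axis_point _ hd1 _ (fun x => x ^+ 2)) ?expr0n//.
  rewrite config_position_out// exprMn !sqr_sqrtr//.
    by rewrite addr_ge0// sqr_ge0.
- have [[_ mpihat] _] := pihatM.
  rewrite -[X in measurable X]setTI.
  exact: (mobs measurableT _ (measurableC (mpihat pi))).
move=> w closer.
apply: (M_estimator_avoids_le_max le pi pihat _ i0 out) => //.
rewrite /observe /= !tnth_mktuple /Defs.edist; apply: ler_wsqrtr.
congr (_ <= _): closer; apply: eq_bigr => k _; rewrite !tnth_mktuple.
- rewrite config_sigma_in config_sigma_out// config_position_in//=.
  by rewrite mulr0 oppr0 if_same add0r mul1r.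
- rewrite config_sigma_in config_position_in//=.
  by rewrite mulr0 oppr0 if_same !add0r !mul1r.
Qed.
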